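(* For every positive integer $n$, the engulfing and the soft engulfing are equivalent properties, i.e., $E^{\mathrm{soft}}(n)=E(n)$.
   Context: For a convex function $\varphi:\mathbb{R}^n\to\mathbb{R}$ and $x_0\in\mathbb{R}^n$, the subdifferential is $\partial\varphi(x_0)=\{p\in\mathbb{R}^n:\ \varphi(x)\ge\varphi(x_0)+p\cdot(x-x_0)\ \ \forall x\in\mathbb{R}^n\}$. For $x_0\in\mathbb{R}^n$, $p\in\partial\varphi(x_0)$ and $s>0$, the section of $\varphi$ at $(x_0,p)$ with height $s$ is $$S_\varphi(x_0,p,s)=\{x\in\mathbb{R}^n:\ \varphi(x)-\varphi(x_0)-p\cdot(x-x_0)<s\}.$$ For $K>1$: - $E(n,K)$ denotes the class of convex functions $\varphi:\mathbb{R}^n\to\mathbb{R}$ having the engulfing property with constant $K$: for any $x\in\mathbb{R}^n$, $p\in\partial\varphi(x)$ and $t>0$, if $y\in S_\varphi(x,p,t)$, then $S_\varphi(x,p,t)\subset S_\varphi(y,q,Kt)$ for every $q\in\partial\varphi(y)$. - $E^{\mathrm{soft}}(n,K)$ denotes the class of convex functions $\varphi:\mathbb{R}^n\to\mathbb{R}$ having the soft engulfing property with constant $K$: for any $x\in\mathbb{R}^n$, $p\in\partial\varphi(x)$ and $t>0$, if $y\in S_\varphi(x,p,t)$, then $x\in S_\varphi(y,q,Kt)$ for every $q\in\partial\varphi(y)$. Neither differentiability of $\varphi$ nor boundedness of its sections is required in these definitions. Set $E(n)=\bigcup_{K>1}E(n,K)$ and $E^{\mathrm{soft}}(n)=\bigcup_{K>1}E^{\mathrm{soft}}(n,K)$.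 *)

(* Defs.v *)
From mathcomp Require Import all_boot all_order all_algebra.
From mathcomp Require Import boolp classical_sets reals convex.
Set Implicit Arguments.
Unset Strict Implicit.
Unset Printing Implicit Defensive.
Import Order.TTheory GRing.Theory Num.Theory.
Local Open Scope classical_set_scope.
Local Open Scope ring_scope.

(* The library's [dotmx] needs a numClosedFieldType, hence this real version. *)
Definition dotr (R : realType) (n : nat) (u v : 'rV[R]_n) : R :=
  \sum_(i < n) u 0 i * v 0 i.

Definition subdifferential (R : realType) (n : nat) (phi : 'rV[R]_n -> R)
    (x0 : 'rV[R]_n) : set 'rV[R]_n :=
  [set p | forall x, phi x >= phi x0 + dotr p (x - x0)].

(* Total in p and s; only used for p in the subdifferential at x0 and s > 0. *)
Definition section (R : realType) (n : nat) (phi : 'rV[R]_n -> R)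
    (x0 p : 'rV[R]_n) (s : R) : set 'rV[R]_n :=
  [set x | phi x - phi x0 - dotr p (x - x0) < s].

Definition engulfing_class (R : realType) (n : nat) (K : R) :
    set ('rV[R]_n -> R) :=
  [set phi : 'rV[R]_n -> R | @convex_function R 'rV[R]_n setT phi /\
    forall (x p : 'rV[R]_n) (t : R), subdifferential phi x p -> 0 < t ->
    forall y, section phi x p t y ->
    forall q, subdifferential phi y q ->
      section phi x p t `<=` section phi y q (K * t)].

Definition soft_engulfing_class (R : realType) (n : nat) (K : R) :
    set ('rV[R]_n -> R) :=
  [set phi : 'rV[R]_n -> R | @convex_function R 'rV[R]_n setT phi /\
    forall (x p : 'rV[R]_n) (t : R), subdifferential phi x p -> 0 < t ->
    forall y, section phi x p t y ->
    forall q, subdifferential phi y q ->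
      section phi y q (K * t) x].

Definition engulfing (R : realType) (n : nat) : set ('rV[R]_n -> R) :=
  \bigcup_(K in [set K : R | 1 < K]) @engulfing_class R n K.

Definition soft_engulfing (R : realType) (n : nat) : set ('rV[R]_n -> R) :=
  \bigcup_(K in [set K : R | 1 < K]) @soft_engulfing_class R n K.

Arguments engulfing : clear implicits.
Arguments soft_engulfing : clear implicits.

(* Main.v *)
Require Import Defs.
From mathcomp Require Import all_boot all_order all_algebra.
From mathcomp Require Import boolp classical_sets reals convex.
From mathcomp Require Import interval_inference ring lra.

(** Engulfing gives soft engulfing because x lies in each of its own sections.
    For the converse write D x p y = phi y - phi x - p.(y - x), so that soft
    engulfing with constant K says D y q x <= K * D x p y. Comparing D between
    z and the reflected point u = x - (z - x)/(2K), in both directions, bounds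
    D x p u by a multiple of D x p z. Testing q in the subdifferential at y
    against u then bounds -q.(z - x), hence D y q z. This uses
    subgradients at z and at u; they exist because a convex function f with
    f 0 = 0 can be successively replaced by smaller ones that still vanish at 0
    and are affine along e_1, ..., e_n. *)

Set Implicit Arguments.
Unset Strict Implicit.
Unset Printing Implicit Defensive.
Import Order.TTheory GRing.Theory Num.Theory.
Local Open Scope classical_set_scope.
Local Open Scope ring_scope.

(** * Convex functions on a vector space and minorants affine in one direction *)

Section AffineMinorant.
Context (R : realType) (E : lmodType R).
Implicit Types (f g : E -> R) (e v w x y : E) (a b c s t : R).

(* Division-free form of convexity: the weights need not add up to 1. *)
Definition weighted_convex f := forall s t w x y, 0 <= s -> 0 <= t ->
  (s + t) *: w = s *: x + t *: y -> (s + t) * f w <= s * f x + t * f y.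

Lemma convex_function_weighted f :
  @convex_function R E setT f -> weighted_convex f.
Proof.
move=> cf s t w x y s0 t0 wE.
have [st0|st0] := eqVneq (s + t) 0.
  have -> : s = 0 by lra.
  have -> : t = 0 by lra.
  by rewrite addr0 !mul0r addr0.
have st_gt0 : 0 < s + t by rewrite lt_neqAle eq_sym st0 addr_ge0.
have p0 : 0 <= s / (s + t) by rewrite divr_ge0 // ltW.
have p1 : s / (s + t) <= 1 by rewrite ler_pdivrMr // mul1r lerDl.
have tE : 1 - s / (s + t) = t / (s + t) by field.
have fle : f ((s / (s + t)) *: x + (t / (s + t)) *: y) <=
    s / (s + t) * f x + t / (s + t) * f y.
  by rewrite -tE; exact: cf (Itv01 p0 p1) x y (in_setT _) (in_setT _).
have wE' : w = (s / (s + t)) *: x + (t / (s + t)) *: y.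
  apply: (scalerI st0); rewrite wE scalerDr !scalerA.
  by congr (_ *: _ + _ *: _); field.
rewrite wE'; apply: le_trans (ler_wpM2l (ltW st_gt0) fle) _.
rewrite le_eqVlt; apply/orP; left; apply/eqP.
by field.
Qed.

(** Convexity at 0, between [s *: e] and [- t *: e], puts f(s e)/s above -f(-t e)/t for s, t > 0.
    Hence the infimum of the quotients with s > 0 is finite, and it serves as slope on both sides of
    0. *)
Lemma slope_exists f e : weighted_convex f -> f 0 = 0 ->
  exists c, forall s, c * s <= f (s *: e).
Proof.
move=> cf f0; pose A := [set f (s *: e) / s | s in [set s | 0 < s]].
have An0 : A !=set0 by exists (f (1 *: e) / 1); exists 1 => //=.
have lbA t : 0 < t -> lbound A (- (f (- t *: e) / t)).
  move=> t0 _ [s /= s0 <-].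
  have := cf s t 0 (- t *: e) (s *: e) (ltW s0) (ltW t0).
  rewrite f0 scaler0 mulr0 !scalerA -scalerDl => /(_ _).
  rewrite mulrN [t * s]mulrC addNr scale0r => /(_ erefl) h.
  by rewrite -mulNr ler_pdivrMr // mulrAC ler_pdivlMr //; lra.
exists (inf A) => s; case: (ltgtP s 0) => [s0|s0|->].
- have s0' : 0 < - s by lra.
  have := lb_le_inf An0 (lbA _ s0').
  by rewrite opprK -mulNr ler_pdivrMr //; lra.
- rewrite -ler_pdivlMr //; apply: ge_inf; first by exists (- (f (- 1 *: e) / 1)); exact: lbA.
  by exists s.
- by rewrite mulr0 scale0r f0.
Qed.

Definition affine_along f e c := forall v s, f (v + s *: e) = f v + s * c.

Lemma affine_along_le f e c :
  (forall v s, f (v + s *: e) <= f v + s * c) -> affine_along f e c.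
Proof.
move=> h v s; apply/eqP; rewrite eq_le h /=.
by have := h (v + s *: e) (- s); rewrite -addrA -scalerDl addrN scale0r addr0; lra.
Qed.

(* [g] is the infimal convolution of [f] with the linear function of slope [c]
   on the line spanned by [e]. *)
Lemma affine_along_minorant f e : weighted_convex f -> f 0 = 0 ->
  exists g c, [/\ weighted_convex g, g 0 = 0, (forall v, g v <= f v),
    affine_along g e c &
    forall e' c', affine_along f e' c' -> affine_along g e' c'].
Proof.
move=> cf f0; have [c hc] := slope_exists e cf f0.
pose A v := range (fun t => f (v + t *: e) - c * t).
have An0 v : A v !=set0 by exists (f (v + 0 *: e) - c * 0); exists 0.
have lbA v : has_lbound (A v).
  (* The midpoint of v + t e and -v is (t/2) e, where f is at least c t/2. *)
  exists (- f (- v)) => _ [t _ <-].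
  have := cf 1 1 ((t / 2) *: e) (v + t *: e) (- v) ler01 ler01.
  have -> : (1 + 1) *: ((t / 2) *: e) = 1 *: (v + t *: e) + 1 *: - v.
    rewrite !scale1r addrAC addrN add0r scalerA; congr (_ *: _); by field.
  by move=> /(_ erefl); have := hc (t / 2); lra.
pose g v := inf (A v).
have gle v t : g v <= f (v + t *: e) - c * t.
  by apply: ge_inf => //; exists t.
have leg v r : (forall t, r <= f (v + t *: e) - c * t) -> r <= g v.
  by move=> h; apply: lb_le_inf => // _ [t _ <-].
exists g, c; split.
- move=> s t w x y s0 t0 wE.
  have [st0|st0] := eqVneq (s + t) 0.
    have -> : s = 0 by lra.
    have -> : t = 0 by lra.
    by rewrite addr0 !mul0r addr0.
  have st_gt0 : 0 < s + t by rewrite lt_neqAle eq_sym st0 addr_ge0.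
  apply/ler_addgt0Pr => eps eps0.
  have d0 : 0 < eps / (s + t) by rewrite divr_gt0.
  have hinf v : has_inf (A v) by split.
  (* Near-minimisers [a] at x and [b] at y; their weighted mean [r] is a competitor at w. *)
  have [_ [a _ <-] ha] := inf_adherent d0 (hinf x).
  have [_ [b _ <-] hb] := inf_adherent d0 (hinf y).
  pose r := (s * a + t * b) / (s + t).
  have rE : (s + t) * r = s * a + t * b by rewrite /r; field.
  have := cf s t (w + r *: e) (x + a *: e) (y + b *: e) s0 t0.
  have -> : (s + t) *: (w + r *: e) = s *: (x + a *: e) + t *: (y + b *: e).
    by rewrite !scalerDr wE !scalerA rE scalerDl addrACA.
  move=> /(_ erefl) hf.
  have h1 := ler_wpM2l (ltW st_gt0) (gle w r).
  have h2 := ler_wpM2l s0 (ltW ha).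
  have h3 := ler_wpM2l t0 (ltW hb).
  have h4 : (s + t) * (eps / (s + t)) = eps by field.
  rewrite -/(g x) in h2; rewrite -/(g y) in h3.
  have h5 : c * ((s + t) * r) = c * (s * a + t * b) by rewrite rE.
  by lra.
- apply/eqP; rewrite eq_le; apply/andP; split.
    by have := gle 0 0; rewrite scale0r addr0 f0; lra.
  by apply: leg => t; rewrite add0r; have := hc t; lra.
- by move=> v; have := gle v 0; rewrite scale0r addr0; lra.
- apply: affine_along_le => v s; rewrite -lerBlDr; apply: leg => t.
  have := gle (v + s *: e) (t - s).
  by rewrite -addrA -scalerDl [s + _]addrC subrK; lra.
- move=> e' c' h; apply: affine_along_le => v s; rewrite -lerBlDr.
  apply: leg => t; have := gle (v + s *: e') t.
  by rewrite addrAC h; lra.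
Qed.

End AffineMinorant.

(** * Linearity of the dot product in its second argument *)

Section Dotr.
Context (R : realType) (n : nat).
Implicit Types u v w : 'rV[R]_n.

Lemma dotrDr u v w : dotr u (v + w) = dotr u v + dotr u w.
Proof.
by rewrite -big_split; apply: eq_bigr => i _; rewrite mxE mulrDr.
Qed.

Lemma dotrZr a u v : dotr u (a *: v) = a * dotr u v.
Proof.
by rewrite /dotr mulr_sumr; apply: eq_bigr => i _; rewrite mxE mulrCA.
Qed.

Lemma dotrNr u v : dotr u (- v) = - dotr u v.
Proof. by rewrite -scaleN1r dotrZr mulN1r. Qed.

End Dotr.

(** * Existence of subgradients *)

Section Subgradient.
Context (R : realType) (n : nat).
Implicit Types (f phi : 'rV[R]_n -> R) (x : 'rV[R]_n).

Lemma linear_minorant f : weighted_convex f -> f 0 = 0 ->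
  exists p : 'rV[R]_n, forall v, dotr p v <= f v.
Proof.
move=> cf f0.
have [g [p [g0 gf hg]]] : exists g (p : 'rV[R]_n), [/\ g 0 = 0,
    (forall v, g v <= f v) &
    forall i, i \in enum 'I_n -> affine_along g (delta_mx 0 i) (p 0 i)].
  suff [g [p [_ ? ? ?]]] : exists g (p : 'rV[R]_n), [/\ weighted_convex g,
      g 0 = 0, (forall v, g v <= f v) &
      forall i, i \in enum 'I_n -> affine_along g (delta_mx 0 i) (p 0 i)].
    by exists g, p.
  elim: (enum 'I_n) => [|j s [g [p [cg g0 gf hg]]]]; first by exists f, 0.
  have [h [c [ch h0 hle hj hkeep]]] := affine_along_minorant (delta_mx 0 j) cg g0.
  exists h, (\row_i if i == j then c else p 0 i); split => //.
    by move=> v; apply: le_trans (hle v) (gf v).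
  move=> i; rewrite inE mxE; case: eqP => [-> //|_] /= /hg; exact: hkeep.
exists p => v; apply: le_trans (gf v).
rewrite le_eqVlt; apply/orP; left; apply/eqP.
rewrite {2}(row_sum_delta v) /dotr.
(* Starting from g 0 = 0, each coordinate added to the argument contributes its own slope. *)
elim: (index_enum 'I_n) => [|i s IH]; first by rewrite !big_nil g0.
rewrite !big_cons IH [v 0 i *: _ + _]addrC hg ?mem_enum //.
by rewrite addrC mulrC.
Qed.

Lemma subdifferential_nonempty phi x :
  weighted_convex phi -> exists p, subdifferential phi x p.
Proof.
move=> cphi; pose f v := phi (x + v) - phi x.
have cf : weighted_convex f.
  move=> s t w y z s0 t0 wE.
  have := cphi s t (x + w) (x + y) (x + z) s0 t0.
  rewrite !scalerDr wE scalerDl addrACA => /(_ erefl).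
  by rewrite /f; lra.
have f0 : f 0 = 0 by rewrite /f addr0 subrr.
have [p hp] := linear_minorant cf f0.
by exists p => y; have := hp (y - x); rewrite /f [x + _]addrC subrK; lra.
Qed.

End Subgradient.

(** * From soft engulfing to engulfing *)

Section SoftEngulfing.
Context (R : realType) (n : nat) (K : R) (phi : 'rV[R]_n -> R).
Implicit Types x y z p q : 'rV[R]_n.

(** The Bregman divergence, with a subgradient in place of the gradient; sections are its strict
    sublevel sets in y. *)
Definition bregman x p y : R := phi y - phi x - dotr p (y - x).

Lemma bregman_ge0 x p y : subdifferential phi x p -> 0 <= bregman x p y.
Proof. by move=> /(_ y); rewrite /bregman; lra. Qed.

(** Sections are open conditions of positive height, so the height is taken to be
    [bregman x p y + eps] and eps tends to 0. *)
Lemma bregman_sym x p y q (K1 : 1 < K)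
    (phi_soft : soft_engulfing_class K phi) :
  subdifferential phi x p ->
  subdifferential phi y q -> bregman y q x <= K * bregman x p y.
Proof.
move=> hp hq; have K0 : 0 < K by lra.
rewrite -ler_pdivrMl //; apply/ler_addgt0Pr => eps eps0.
have D0 := bregman_ge0 y hp.
have t0 : 0 < bregman x p y + eps by lra.
have := phi_soft.2 x p _ hp t0 y _ q hq; rewrite /section /= => /(_ _) h.
rewrite ler_pdivrMl //; apply/ltW/h.
by rewrite -/(bregman x p y); lra.
Qed.

(** With U, M the values of D x p at u, z, the bound D u q z <= K * D z a u leaves U with
    coefficient 1/eps - K. The choice eps = 1/(2K) makes it K > 0. *)
Lemma bregman_reflection x p z (K1 : 1 < K)
    (phi_soft : soft_engulfing_class K phi) :
  subdifferential phi x p ->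
  bregman x p (x - (2 * K)^-1 *: (z - x)) <= 2 * K * bregman x p z.
Proof.
move=> hp; set eps := (2 * K)^-1; set u := x - _.
have cphi := convex_function_weighted phi_soft.1.
have [a ha] := subdifferential_nonempty z cphi.
have [q hq] := subdifferential_nonempty u cphi.
have zx := bregman_sym K1 phi_soft hp ha.
have ux := bregman_sym K1 phi_soft hp hq.
have zu := bregman_sym K1 phi_soft ha hq.
have m0 := bregman_ge0 z hp.
have xu : x - u = eps *: (z - x) by rewrite /u opprB addrC subrK.
have zuE : z - u = (1 + eps) *: (z - x).
  by rewrite scalerDl scale1r -xu addrA subrK.
have uz0 := bregman_ge0 x hq.
have epsK : 2 * K * eps = 1 by rewrite /eps; field; lra.
have eps0 : 0 < eps by rewrite /eps invr_gt0; lra.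
move: zx ux zu m0 uz0; rewrite /bregman.
rewrite -[x - z]opprB -[u - x]opprB -[u - z]opprB xu zuE !dotrNr !dotrZr.
move: (dotr p _) (dotr a _) (dotr q _) => P A Q zx ux zu m0 uz0.
set M := phi z - phi x - P in zx m0 *.
set U := phi u - phi x - - (eps * P).
set A' := A - P; set Q' := Q - P.
have hA : A' <= (1 + K) * M by rewrite /A' /M in zx *; lra.
(* This is D u q x >= 0. *)
have hQ : eps * Q' <= - U by rewrite /U /Q'; lra.
have hQ' : Q' <= - (2 * K * U).
  have h := ler_wpM2l (_ : 0 <= 2 * K) hQ.
  by have := h ltac:(lra); rewrite mulrA epsK; lra.
have zuE' : M - U - (1 + eps) * Q' <= K * (U - M + (1 + eps) * A').
  by rewrite /M /U /A' /Q'; lra.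
have hA2 : (1 + eps) * A' <= (1 + eps) * ((1 + K) * M) by rewrite ler_pM2l //; lra.
have hA3 := ler_wpM2l (_ : 0 <= K) hA2; have := hA3 ltac:(lra) => {}hA3.
have hQ2 : (1 + eps) * Q' <= (1 + eps) * - (2 * K * U) by rewrite ler_pM2l //; lra.
have e1 : (1 + eps) * - (2 * K * U) = - (2 * K * U) - U.
  by have := congr1 ( *%R^~ U) epsK; rewrite mul1r; lra.
have e2 : K * ((1 + eps) * ((1 + K) * M)) = (K + 2^-1) * (1 + K) * M.
  have -> : 2^-1 = K * eps by rewrite /eps; field; lra.
  by ring.
rewrite e1 in hQ2; rewrite e2 in hA3.
(* The bounds combine to K U <= (K - 1/2)(K + 1) M, which is at most 2 K^2 M. *)
have h : K * U <= K * (2 * K * M) by nra.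
by move: h; rewrite ler_pM2l //; lra.
Qed.

(** The constant adds up three bounds: t for D x p z, K t for D y q x, and 2K * 3K t for -(q - p).(z
    - x). *)
Lemma soft_engulfing_class_engulfing (K1 : 1 < K)
    (phi_soft : soft_engulfing_class K phi) :
  engulfing_class (1 + K + 6 * K ^+ 2) phi.
Proof.
split; first exact: phi_soft.1.
move=> x p t hp t0 y hy q hq z hz.
rewrite /section /= in hy hz *.
have yx := bregman_sym K1 phi_soft hp hq.
have := bregman_reflection z K1 phi_soft hp.
set u := x - _ => ur.
have xu : u - x = - ((2 * K)^-1 *: (z - x)) by rewrite /u addrAC subrr add0r.
have := hq u.
have -> : u - y = (u - x) - (y - x) by rewrite opprB addrA subrK.
have -> : z - y = (z - x) - (y - x) by rewrite opprB addrA subrK.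
move: ur yx; rewrite /bregman -[x - y]opprB xu.
move: hy hz; move: (y - x) (z - x) => dy dz.
rewrite !dotrDr !dotrNr !dotrZr.
move: (dotr p dy) (dotr p dz) (dotr q dy) (dotr q dz).
move=> Py Pz Qy Qz hy hz; set eps := (2 * K)^-1 => ur yx qu.
have epsK : 2 * K * eps = 1 by rewrite /eps; field; lra.
set U := phi u - phi x - - (eps * Pz) in ur.
have hQz : eps * - (Qz - Pz) <= U - (phi y - phi x - Py) + (Qy - Py).
  by rewrite /U; lra.
have K0 : 0 <= 2 * K by lra.
have := ler_wpM2l K0 hQz; rewrite mulrA epsK mul1r => {}hQz.
have kt : K * (phi y - phi x - Py) <= K * t by rewrite ler_pM2l //; lra.
have kz : 2 * K * (phi z - phi x - Pz) <= 2 * K * t by rewrite ler_pM2l //; lra.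
(* U contributes 2K t by reflection; the remaining terms are D y q x, at most K t. *)
have hU : U - (phi y - phi x - Py) + (Qy - Py) <= 3 * K * t by lra.
have := ler_wpM2l K0 hU => hU2.
by rewrite expr2; lra.
Qed.

End SoftEngulfing.

Theorem theorem3p1 (R : realType) (n : nat) (n_gt0 : (0 < n)%N) :
  soft_engulfing R n = engulfing R n.
Proof.
apply/seteqP; split => phi [K /= K1 hphi].
  exists (1 + K + 6 * K ^+ 2); last exact: soft_engulfing_class_engulfing.
  by rewrite /=; have := sqr_ge0 K; lra.
exists K => //; split; first exact: hphi.1.
move=> x p t hp t0 y hy q hq; apply: (hphi.2 x p t hp t0 y hy q hq).
by rewrite /section /= !subrr add0r /dotr big1 ?oppr0 // => i _; rewrite mxE mulr0.
Qed.
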